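(* Let $r\geq1$ and $e\geq2$ be integers, let $\mathbf{a}=(a_1,\dots,a_r)\in(\mathbb{Z}/e\mathbb{Z})^r$, and let $\Theta=\Theta(e;\mathbf{a})$ be the $(e;\mathbf{a})$-hub of the empty multipartition. Let $\theta$ be an $e$-hub. The following are equivalent. (1) There exists an $(e;\mathbf{a})$-block with hub $\theta$. (2) $\Theta\stackrel{e}{\mapsto}\theta$. (3) $\left(\sum_{i\in\mathbb{Z}/e\mathbb{Z}}i\theta_i\right)+e\mathbb{Z}=\left(\sum_{i\in\mathbb{Z}/e\mathbb{Z}}i\Theta_i\right)+e\mathbb{Z}$, that is, $\sum_{x=0}^{e-1}x\,\theta_{x+e\mathbb{Z}}\equiv\sum_{x=0}^{e-1}x\,\Theta_{x+e\mathbb{Z}}\pmod e$.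
   Context: Multipartitions. A multipartition is an $r$-tuple $\boldsymbol{\lambda}=(\lambda^{(1)},\dots,\lambda^{(r)})$ of partitions, identified with its Young diagram $\{(i,j)_k : i,j\geq 1,\ 1\leq k\leq r,\ j\leq\lambda^{(k)}_i\}$, whose elements are called nodes. A node of $\boldsymbol{\lambda}$ is removable if deleting it leaves the Young diagram of a multipartition; a node not in $\boldsymbol{\lambda}$ is addable if adding it gives the Young diagram of a multipartition. Residues and blocks. The residue of $(i,j)_k$ is $j-i+a_k\in\mathbb{Z}/e\mathbb{Z}$; a node of residue $l$ is an $l$-node. For $l\in\mathbb{Z}/e\mathbb{Z}$, $c_l(\boldsymbol{\lambda})$ is the number of $l$-nodes of $\boldsymbol{\lambda}$; the content of $\boldsymbol\lambda$ is $(c_l(\boldsymbol\lambda))_{l}$. An $(e;\mathbf{a})$-block is an equivalence class of multipartitions under the relation of having the same content. Hubs. An $e$-hub is a tuple $\theta=(\theta_i)_{i\in\mathbb{Z}/e\mathbb{Z}}$ of integers with $\sum_i\theta_i=-r$. The hub of $\boldsymbol\lambda$ is $(\theta_i(\boldsymbol\lambda))_{i}$, where $\theta_i(\boldsymbol\lambda)$ is the number of removable $i$-nodes minus the number of addable $i$-nodes of $\boldsymbol\lambda$. All multipartitions in a block have the same hub, called the hub of the block. $\Theta$ is given by $\Theta_i=-|\{j\in\{1,\dots,r\}: a_j=i\}|$. The relation $\stackrel{e}{\mapsto}$. For $i\in\mathbb{Z}/e\mathbb{Z}$ let $\alpha_i\in\mathbb{Z}^{\mathbb{Z}/e\mathbb{Z}}$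 be given by $(\alpha_i)_j=-\delta_{(i-1)j}+2\delta_{ij}-\delta_{(i+1)j}$, with $\delta$ the Kronecker delta. For $x,y\in\mathbb{Z}^{\mathbb{Z}/e\mathbb{Z}}$, $x\stackrel{e}{\mapsto}y$ means $y-x=\sum_{i\in\mathbb{Z}/e\mathbb{Z}}m_i\alpha_i$ for some non-negative integers $m_i$ (equivalently, since $\sum_i\alpha_i=0$, for some integers $m_i$). *)

(* Defs.v *)
From mathcomp Require Import all_boot all_order all_algebra finmap.
From mathcomp Require Import boolp classical_sets cardinality.

Set Implicit Arguments.
Unset Strict Implicit.
Unset Printing Implicit Defensive.

Import Order.TTheory GRing.Theory Num.Theory.
Local Open Scope classical_set_scope.
Local Open Scope ring_scope.

(* Trailing zeros are dropped, so each partition has exactly one code. *)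
Record partition := Partition {
  parts :> seq nat;
  partsP : sorted geq parts && (0%N \notin parts) }.

(* The part [la_i], with [i >= 1]; it is [0] beyond the length. *)
Definition part (la : partition) (i : nat) : nat := nth 0%N la i.-1.

Definition empty_partition : partition := @Partition [::] isT.

Notation multipartition r := {ffun 'I_r -> partition}.

Definition empty_multipartition r : multipartition r :=
  [ffun _ => empty_partition].

(* The triple [(i, j, k)] is the node [(i,j)_k]; rows and columns are counted
   from 1, components from 0. *)
Notation node r := (nat * nat * 'I_r)%type.

Definition diagram r (la : multipartition r) : set (node r) :=
  [set n | let: (i, j, k) := n in
           [/\ (1 <= i)%N, (1 <= j)%N & (j <= part (la k) i)%N]].

Definition is_diagram r (A : set (node r)) : Prop :=
  exists mu : multipartition r, diagram mu = A.

Definition removable r (la : multipartition r) : set (node r) :=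
  [set n | diagram la n /\ is_diagram (diagram la `\ n)].

(* The conditions [1 <= i, j] need not be imposed: they hold in any diagram. *)
Definition addable r (la : multipartition r) : set (node r) :=
  [set n | ~ diagram la n /\ is_diagram (n |` diagram la)].

(* Cardinality of a finite set (it would be [0] on an infinite one; it is only
   used on sets of nodes, addable nodes or removable nodes, which are finite). *)
Definition ncard (T : choiceType) (A : set T) : nat := #|` fset_set A|.

(* ['Z_e] is the ring of integers mod [e] when [1 < e]. *)
Definition residue r e (a : {ffun 'I_r -> 'Z_e})
    (n : node r) : 'Z_e :=
  let: (i, j, k) := n in j%:R - i%:R + a k.

Definition content r e (a : {ffun 'I_r -> 'Z_e})
    (la : multipartition r) : {ffun 'Z_e -> nat} :=
  [ffun l => ncard [set n | diagram la n /\ residue a n = l]].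

Definition is_block r e (a : {ffun 'I_r -> 'Z_e})
    (B : set (multipartition r)) : Prop :=
  exists la, B = [set mu | content a mu = content a la].

Definition hub r e (a : {ffun 'I_r -> 'Z_e})
    (la : multipartition r) : {ffun 'Z_e -> int} :=
  [ffun l => (ncard [set n | removable la n /\ residue a n = l])%:Z
           - (ncard [set n | addable la n /\ residue a n = l])%:Z].

(* Meaningful for nonempty [B], in particular for a block. *)
Definition has_hub r e (a : {ffun 'I_r -> 'Z_e})
    (B : set (multipartition r)) (theta : {ffun 'Z_e -> int}) : Prop :=
  forall la, B la -> hub a la = theta.

Definition Theta r e (a : {ffun 'I_r -> 'Z_e}) : {ffun 'Z_e -> int} :=
  hub a (empty_multipartition r).

Definition is_ehub (r e : nat) (theta : {ffun 'Z_e -> int}) : Prop :=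
  \sum_(i : 'Z_e) theta i = - r%:Z.

Definition alpha (e : nat) (i : 'Z_e) : {ffun 'Z_e -> int} :=
  [ffun j => - (i - 1 == j)%:R + 2 * (i == j)%:R - (i + 1 == j)%:R].

Definition emapsto (e : nat) (x y : {ffun 'Z_e -> int}) : Prop :=
  exists m : 'Z_e -> nat, y - x = \sum_(i : 'Z_e) alpha i *+ m i.

(* Main.v *)
Require Import Defs.
From mathcomp Require Import all_boot all_order all_algebra.
From mathcomp Require Import finmap zify ring.
From mathcomp Require Import classical_sets cardinality.

Set Implicit Arguments.
Unset Strict Implicit.
Unset Printing Implicit Defensive.

Import Order.TTheory GRing.Theory Num.Theory.
Local Open Scope classical_set_scope.
Local Open Scope ring_scope.

(** Write [c_l] for the content of a multipartition and [theta_l] for its hub.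

    Everything rests on the identity
      [theta_l - Theta_l = 2 c_l - c_(l+1) - c_(l-1)]    ([hub_sub_Theta]).
    Along a row of the diagram the residues are consecutive, so the second
    difference on the right telescopes, leaving only the two ends of the row.
    The left ends telescope again down the first column.  At the right ends,
    the last node of a row and the empty position just beyond the next row
    have the same residue when the two rows have equal lengths, and these
    cancel; what survives is exactly the removable and the addable nodes
    ([rim_telescope]).

    (1) => (2): the right-hand side is the [l]-coordinate of the sum of the
    [c_i alpha_i], so the content itself provides the multiplicities.

    (2) => (3): the moment of [alpha_i] is congruent to
    [-(i-1) + 2i - (i+1) = 0] mod [e].

    (3) => (1): put [n_l = c_l - c_(l+1)], so that the identity above reads
    [theta_l - Theta_l = n_l - n_(l-1)].  Given [theta], the sum condition makes
    this equation for [n] solvable around the cycle, uniquely up to a constant,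
    and the congruence (3) says that the constant can be chosen so that the
    [n_l] sum to [0] ([cyclic_primitive]).  It remains to find a multipartition
    whose content has the prescribed differences [n_l], and a single nonempty
    component suffices.  A row contributes to [n] one unit at the residue of
    its last node, and minus one unit at the residue preceding that of its
    first node.  With [e T] rows the latter cover every residue exactly [T]
    times ([sum_residues]), while the residues of the last nodes can be
    prescribed freely: the rows of a partition may be lengthened to hit any
    residue as long as each is allowed to be longer than the next by up to
    about [2 e] ([partition_of_row_ends]).  Taking [T] large, let [T + n_l]
    rows end at [l].  Since the content determines the hub, the block of this
    multipartition has hub [theta]. *)

(** * Partitions and their rows *)

Lemma part_geq (la : Defs.partition) i j :
  (i <= j)%N -> (part la j <= part la i)%N.
Proof.
move=> le_ij; rewrite /part.
case/andP: (partsP la) => srt _.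
have [lt_j|ge_j] := ltnP j.-1 (size la); last first.
  by rewrite [X in (X <= _)%N]nth_default.
have geq_trans : transitive geq by move=> ? ? ? h1 h2; apply: leq_trans h2 h1.
have := @sorted_leq_nth _ geq geq_trans (@leqnn) 0%N _ srt i.-1 j.-1.
by rewrite !inE; apply; lia.
Qed.

Lemma part_default (la : Defs.partition) i : (size la < i)%N -> part la i = 0%N.
Proof. by move=> lt_i; rewrite /part nth_default //; lia. Qed.

Lemma partition_of_rows (f : nat -> nat) N :
    (forall i, f i.+1 <= f i)%N -> f N = 0%N ->
  exists la : Defs.partition, forall i, part la i.+1 = f i.
Proof.
move=> f_dec fN.
have f_geq i j : (i <= j)%N -> (f j <= f i)%N.
  by move/subnK<-; elim: (j - i)%N => // d IH; apply: leq_trans (f_dec _) IH.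
(* The code has no zeros, so the list stops at the first zero of [f]. *)
have ex0 : exists n, f n == 0%N by exists N; rewrite fN.
case: (ex_minnP ex0) => n /eqP fn0 n_min.
have wf : sorted geq (mkseq f n) && (0%N \notin mkseq f n).
  apply/andP; split.
    apply/(sortedP 0%N) => i; rewrite size_mkseq => lt_i.
    by rewrite !nth_mkseq ?(ltnW lt_i) // /geq /= f_dec.
  apply/mapP => -[i]; rewrite mem_iota => lt_i fi0.
  by have := n_min i; rewrite -fi0 eqxx => /(_ isT); lia.
exists (Partition wf) => i; rewrite /part /=.
have [lt_i|ge_i] := ltnP i n; first by rewrite nth_mkseq.
by rewrite nth_default ?size_mkseq //; have := f_geq _ _ ge_i; lia.
Qed.

(** * Removable and addable nodes *)

Lemma diagram_down r (la : multipartition r) i j k i' j' :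
  diagram la (i, j, k) -> (1 <= i' <= i)%N -> (1 <= j' <= j)%N ->
  diagram la (i', j', k).
Proof.
move=> [i1 j1 jle] /andP[i'1 i'i] /andP[j'1 j'j]; split=> //.
by apply: leq_trans j'j (leq_trans jle (part_geq _ i'i)).
Qed.

(** Deleting or adding a node changes one row only, so this provides the
    multipartitions witnessing removability and addability. *)
Lemma replace_row r (la : multipartition r) i k v :
    (1 <= i)%N -> (part (la k) i.+1 <= v)%N ->
    (i = 1%N \/ v <= part (la k) i.-1)%N ->
  exists mu : multipartition r, forall i' k', (1 <= i')%N ->
    part (mu k') i' = if (i' == i) && (k' == k) then v else part (la k') i'.
Proof.
move=> i1 lev vle.
have [nu nuP] : exists nu : Defs.partition, forall i', part nu i'.+1 =
    (if i'.+1 == i then v else part (la k) i'.+1).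
  apply: (@partition_of_rows _ (i + size (la k)).+1) => [i'|].
    have le1 := @part_geq (la k) i'.+1 i'.+2 (leqnSn _).
    case: eqP => [e1|n1]; case: eqP => [e2|n2] //; try lia.
    - by case: vle; [lia|rewrite -e1].
    - by move: lev; rewrite -e2.
  by rewrite ifN ?part_default //; lia.
exists [ffun k' => if k' == k then nu else la k'] => -[//|i'] k' _.
by rewrite ffunE; case: (k' =P k) => [->|_]; rewrite ?andbT ?andbF // nuP.
Qed.

(** Diagrams are closed under moving left or up, so a node can be deleted only
    if nothing lies to its right or below it. *)
Lemma removableP r (la : multipartition r) i j k :
  removable la (i, j, k) <->
  [/\ (1 <= i)%N, j = part (la k) i & (part (la k) i.+1 < part (la k) i)%N].
Proof.
split=> [[d_n [mu /seteqP[sub sup]]]|[i1 -> lt_i]].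
  have out n' : diagram la n' -> n' <> (i, j, k) -> diagram mu n'.
    by move=> d ne; apply: sup.
  have notin : ~ diagram mu (i, j, k) by move=> /sub[_]; apply.
  case: (d_n) => i1 j1 jle; split=> //.
    apply/eqP; rewrite eqn_leq jle leqNgt; apply/negP => lt_j.
    apply: notin; apply: (@diagram_down _ _ i j.+1);
      rewrite ?i1 ?j1 ?leqnn ?leqnSn //.
    by apply: out => // -[]; lia.
  rewrite ltnNge; apply/negP => le_i.
  apply: notin; apply: (@diagram_down _ _ i.+1 j);
    rewrite ?i1 ?j1 ?leqnn ?leqnSn //.
  apply: out => [|[]]; last by lia.
  by split=> //; apply: leq_trans jle le_i.
split; first by split=> //; lia.
have [|||mu muP] := @replace_row r la i k (part (la k) i).-1 => //; first by lia.
  by right; apply: leq_trans (leq_pred _) (part_geq _ (leq_pred _)).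
exists mu; apply/seteqP; split=> -[[i' j'] k'] /=.
  move=> [i'1 j'1]; rewrite muP //; case: ifP => [/andP[/eqP-> /eqP->] le_j|ne le_j].
    by split; [split=> //; lia | case; lia].
  by split=> // -[e1 _ e3]; move: ne; rewrite e1 e3 !eqxx.
move=> [[i'1 j'1 le_j] ne]; split=> //; rewrite muP //.
case: ifP => // /andP[/eqP e1 /eqP e3]; move: ne le_j; rewrite e1 e3.
case: (j' =P part (la k) i) => [->|]; [by case | lia].
Qed.

Lemma addableP r (la : multipartition r) i j k :
  addable la (i, j, k) <->
  [/\ (1 <= i)%N, j = (part (la k) i).+1 &
      (i == 1%N) || (part (la k) i < part (la k) i.-1)%N].
Proof.
split=> [[d_n [mu /seteqP[sub sup]]]|[i1 -> or_i]].
  have inn : diagram mu (i, j, k) by apply: sup; left.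
  have out n' : diagram mu n' -> n' <> (i, j, k) -> diagram la n'.
    by move=> d ne; case: (sub _ d).
  case: (inn) => i1 j1 jle.
  have ltj : (part (la k) i < j)%N.
    by rewrite ltnNge; apply/negP => le_j; apply: d_n.
  split=> //.
    apply/eqP; rewrite eqn_leq ltj andbT leqNgt; apply/negP => lt_j.
    have [] : diagram la (i, j.-1, k); last by lia.
    apply: out => [|[]]; last by lia.
    by apply: diagram_down inn _ _; lia.
  have [//|ne1] := eqVneq i 1%N; apply: leq_trans ltj _.
  have [] // : diagram la (i.-1, j, k).
  apply: out => [|[]]; last by lia.
  by apply: diagram_down inn _ _; lia.
split; first by case; lia.
have [|||mu muP] := @replace_row r la i k (part (la k) i).+1 => //.
- by apply: leq_trans (part_geq _ (leqnSn _)) _.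
- by case/orP: or_i => [/eqP|]; [left|right].
exists mu; apply/seteqP; split=> -[[i' j'] k'] /=.
  move=> [i'1 j'1]; rewrite muP //; case: ifP => [/andP[/eqP-> /eqP->] le_j|ne le_j].
    by case: (j' =P (part (la k) i).+1) => [->|ne]; [left|right; split=> //; lia].
  by right.
case=> [[-> -> ->]|[i'1 j'1 le_j]]; split=> //; rewrite muP ?eqxx //.
by case: ifP => // /andP[/eqP e1 /eqP e3]; move: le_j; rewrite e1 e3; lia.
Qed.

(** * Counting nodes *)

Lemma ncard_count (T : choiceType) (A : set T) (s : seq T) (p : pred T) :
  uniq s -> (forall x, A x <-> x \in s /\ p x) -> ncard A = count p s.
Proof.
move=> s_uniq AP.
have -> : A = [set` [fset x in [seq x <- s | p x]]%fset].
  apply/seteqP; split=> x /=; rewrite !inE mem_filter.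
    by move/AP=> [-> ->].
  by move=> /andP[? ?]; apply/AP.
by rewrite /ncard set_fsetK card_fseq undup_id ?filter_uniq // size_filter.
Qed.

(** Turns cardinalities of sets of nodes into iterated sums, on which the
    telescoping below can act.  From here on rows are numbered from 0. *)
Lemma ncard_box r (A : set (node r)) N M (p : 'I_r -> nat -> nat -> bool) :
    (forall i j k, A (i, j, k) <->
      [/\ (1 <= i)%N, (i <= N)%N, (j < M)%N & p k i.-1 j]) ->
  (ncard A)%:Z = \sum_(k < r) \sum_(i < N) \sum_(j < M) (p k i j)%:R.
Proof.
move=> AP.
set s := [seq (ij, k) | k <- enum 'I_r,
                        ij <- [seq (i, j) | i <- iota 1 N, j <- iota 0 M]].
have s_uniq : uniq s.
  apply: allpairs_uniq => [||[? ?] [? ?] _ _ [-> ->] //]; first exact: enum_uniq.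
  by apply: allpairs_uniq => [||[? ?] [? ?] _ _ [-> ->] //]; exact: iota_uniq.
have mem_s i j k :
    (((i, j), k) \in s) = [&& (1 <= i)%N, (i <= N)%N & (j < M)%N].
  apply/allpairsP/and3P => [[[k' [i' j']] [_ /allpairsP]]|[i1 iN jM]].
    move=> [[i'' j''] /= [+ + ->]] [-> -> _].
    by rewrite !mem_iota; split; lia.
  exists (k, (i, j)); split=> //; first by rewrite mem_enum.
  by apply/allpairsP; exists (i, j); rewrite !mem_iota; split=> //=; lia.
rewrite (@ncard_count _ A s (fun n : node r => p n.2 n.1.1.-1 n.1.2)) //.
  rewrite -sum1_count big_mkcond /= big_allpairs_dep /=.
  rewrite big_enum -natz natr_sum; apply: eq_bigr => k _.
  rewrite big_allpairs_dep natr_sum -[1%N]/(1 + 0)%N iotaDl !big_map.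
  have -> : iota 0 N = index_iota 0 N by rewrite /index_iota subn0.
  rewrite big_mkord; apply: eq_bigr => i _.
  rewrite natr_sum.
  have -> : iota 0 M = index_iota 0 M by rewrite /index_iota subn0.
  by rewrite big_mkord; apply: eq_bigr => j _ /=; case: (p k i j).
move=> [[i j] k]; rewrite mem_s AP.
split=> [[i1 iN jM ?]|[/and3P[? ? ?] ?]]; split=> //.
by apply/and3P.
Qed.

Definition width r (la : multipartition r) := \max_(k < r) part (la k) 1.

Lemma part_beyond r (la : multipartition r) N k i :
  (forall k, part (la k) N.+1 = 0%N) -> (N < i)%N -> part (la k) i = 0%N.
Proof. by move=> laN /(part_geq (la k)); rewrite laN leqn0 => /eqP. Qed.

Lemma width_bound r (la : multipartition r) k i :
  (1 <= i)%N -> (part (la k) i <= width la)%N.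
Proof.
move=> i1; apply: leq_trans (part_geq (la k) i1) _.
exact: (leq_bigmax (F := fun k => part (la k) 1)).
Qed.

Lemma sum_pick M c (b : bool) (q : nat -> bool) : (c < M)%N ->
  \sum_(j < M) [&& j == c :> nat, b & q j]%:R = b%:R * (q c)%:R :> int.
Proof.
move=> ltc; rewrite (bigD1 (Ordinal ltc)) //= eqxx big1 ?addr0 => [|j].
  by case: b => /=; rewrite ?mul1r ?mul0r.
by rewrite -val_eqE /= => /negbTE ->.
Qed.

(** [a k - i + j] is the residue of the node in row [i] and column [j], both
    counted from 0. *)
Lemma content_sum r e (a : {ffun 'I_r -> 'Z_e}) (la : multipartition r) l N :
    (forall k, part (la k) N.+1 = 0%N) ->
  (content a la l)%:Z =
  \sum_(k < r) \sum_(i < N) \sum_(j < part (la k) i.+1) (a k - i%:R + j%:R == l)%:R.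
Proof.
move=> laN; rewrite ffunE.
rewrite (@ncard_box _ _ N (width la).+1 (fun k i j =>
  [&& (1 <= j)%N, (j <= part (la k) i.+1)%N & residue a (i.+1, j, k) == l])).
  apply: eq_bigr => k _; apply: eq_bigr => i _.
  rewrite big_ord_recl /= add0r.
  have le_w := width_bound la k (ltn0Sn i).
  (* The range of columns, [part (la k) i.+1], varies with the row; it is
     widened to the uniform [width la] at the price of a condition. *)
  rewrite [RHS](big_ord_widen _ (fun j => (a k - i%:R + j%:R == l)%:R) le_w).
  rewrite [RHS]big_mkcond; apply: eq_bigr => j _ /=; rewrite /bump /= add1n.
  case: ifP => //= _; congr (_ == _)%:R.
  by rewrite -[j.+1%:R]natr1 -[i.+1%:R]natr1; ring.
move=> i j k.
split=> [[[i1 j1 jle] /eqP res]|[i1 iN jM /and3P[j1 jle /eqP res]]].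
  split=> //.
  - rewrite leqNgt; apply/negP => lt_i; move: jle.
    by rewrite (part_beyond _ laN); lia.
  - by rewrite ltnS; apply: leq_trans jle (width_bound _ _ i1).
  - by rewrite j1 prednK // jle res.
by move: jle res; rewrite prednK.
Qed.

Lemma removable_sum r e (a : {ffun 'I_r -> 'Z_e}) (la : multipartition r) l N :
    (forall k, part (la k) N.+1 = 0%N) ->
  (ncard [set n | removable la n /\ residue a n = l])%:Z =
  \sum_(k < r) \sum_(i < N) (part (la k) i.+2 < part (la k) i.+1)%:R *
     (a k + (part (la k) i.+1)%:R - i.+1%:R == l)%:R.
Proof.
move=> laN.
rewrite (@ncard_box _ _ N (width la).+1 (fun k i j =>
  [&& j == part (la k) i.+1, (part (la k) i.+2 < part (la k) i.+1)%N
    & residue a (i.+1, j, k) == l])).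
  apply: eq_bigr => k _; apply: eq_bigr => i _.
  rewrite (sum_pick _ (fun j => residue a (i.+1, j, k) == l)) ?ltnS ?width_bound //.
  by rewrite /residue addrAC [_ + a k]addrC.
move=> i j k; split=> [[/removableP[i1 -> lt_i] /eqP res]|[i1 iN jM]].
  split=> //.
  - rewrite leqNgt; apply/negP => lt_N; move: lt_i.
    by rewrite [part _ i](part_beyond _ laN) //; lia.
  - by rewrite ltnS width_bound.
  - by rewrite prednK // eqxx lt_i res.
by rewrite prednK // => /and3P[/eqP-> lt_i /eqP res]; split=> //; apply/removableP.
Qed.

(** One row more than for the removable nodes: the first empty row may carry an
    addable node. *)
Lemma addable_sum r e (a : {ffun 'I_r -> 'Z_e}) (la : multipartition r) l N :
    (forall k, part (la k) N.+1 = 0%N) ->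
  (ncard [set n | addable la n /\ residue a n = l])%:Z =
  \sum_(k < r) \sum_(i < N.+1)
     ((i == 0%N :> nat) || (part (la k) i.+1 < part (la k) i.-1.+1)%N)%:R *
     (a k + (part (la k) i.+1)%:R - i%:R == l)%:R.
Proof.
move=> laN.
rewrite (@ncard_box _ _ N.+1 (width la).+2 (fun k i j =>
  [&& j == (part (la k) i.+1).+1,
      (i == 0%N :> nat) || (part (la k) i.+1 < part (la k) i.-1.+1)%N
    & residue a (i.+1, j, k) == l])).
  apply: eq_bigr => k _; apply: eq_bigr => i _.
  rewrite (sum_pick _ (fun j => residue a (i.+1, j, k) == l)) ?ltnS ?width_bound //.
  congr (_ * (_ == _)%:R).
  rewrite /residue -[X in X - _]natr1 -[i.+1%:R]natr1; ring.
move=> i j k; split=> [[/addableP[i1 -> or_i] /eqP res]|[i1 iN jM]].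
  split=> //.
  - rewrite leqNgt; apply/negP => lt_N; move: or_i.
    rewrite [part _ i.-1](part_beyond _ laN) ?ltn0 //; lia.
  - by rewrite !ltnS width_bound.
  - rewrite prednK // eqxx res andbT /=.
    case: eqP => //= ne; case/orP: or_i => [/eqP|]; first by lia.
    by rewrite prednK //; lia.
rewrite prednK // => /and3P[/eqP-> or_i /eqP res].
split=> //; apply/addableP; split=> //.
case/orP: or_i => [/eqP i0|]; first by apply/orP; left; apply/eqP; lia.
have [->//|ne] := eqVneq i 1%N.
by rewrite prednK //; lia.
Qed.

(** * The hub in terms of the content *)

Lemma telescope_shift (V : pzRingType) (h : V -> int) (t : V) L :
  \sum_(j < L) (h (t + j%:R) - h (t + j%:R - 1)) = h (t + L%:R - 1) - h (t - 1).
Proof.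
elim: L => [|L IH]; first by rewrite big_ord0 addr0 subrr.
have e1 : t + L.+1%:R - 1 = t + L%:R by rewrite -natr1 addrA addrK.
rewrite big_ord_recr /= IH e1; ring.
Qed.

(** A row with residues [t], ..., [t + L - 1]: the second difference leaves the
    first node and the position before it, the last node and the position
    after it. *)
Lemma row_telescope (V : pzRingType) (g : V -> int) (t : V) L :
  \sum_(j < L) (2 * g (t + j%:R) - g (t + j%:R - 1) - g (t + j%:R + 1)) =
  g t - g (t - 1) + g (t + L%:R - 1) - g (t + L%:R).
Proof.
transitivity (\sum_(j < L) ((g (t + j%:R) - g (t + j%:R + 1))
    - (g (t + j%:R - 1) - g (t + j%:R - 1 + 1)))).
  by apply: eq_bigr => j _; rewrite subrK; ring.
by rewrite (telescope_shift (fun x => g x - g (x + 1))) !subrK; ring.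
Qed.

(** Here [g] is any function of the residue, [s] the residue of the corner node
    and [f i] the length of row [i]; the indicators single out the removable
    and the addable nodes.  The terms [g s] and [g (s - K)] come from
    telescoping the left ends of the rows.  Whether row [K - 1] has a removable
    node already depends on row [K], so the addable node of row [K] has to be
    counted too; the term at [s + f K - K] compensates for it, which makes the
    induction on [K] go through.  When [f K = 0] this term cancels against
    [g (s - K)]. *)
Lemma rim_telescope (V : pzRingType) (g : V -> int) (s : V) (f : nat -> nat) K :
    (forall i, f i.+1 <= f i)%N ->
  \sum_(i < K) \sum_(j < f i)
     (2 * g (s - i%:R + j%:R) - g (s - i%:R + j%:R - 1) - g (s - i%:R + j%:R + 1)) =
  \sum_(i < K) (f i.+1 < f i)%:R * g (s + (f i)%:R - i.+1%:R)
  - \sum_(i < K.+1) ((i == 0%N :> nat) || (f i < f i.-1))%N%:R * g (s + (f i)%:R - i%:R)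
  + g s + g (s + (f K)%:R - K%:R) - g (s - K%:R).
Proof.
move=> f_dec; elim: K => [|K IH].
  rewrite !big_ord0 big_ord_recr big_ord0 /= !subr0; ring.
rewrite big_ord_recr IH row_telescope [in RHS]big_ord_recr.
rewrite [X in _ = _ - X + _ + _ - _]big_ord_recr /=.
have -> : s - K%:R - 1 = s - K.+1%:R by rewrite -natr1 opprD addrA.
have -> : s - K%:R + (f K)%:R = s + (f K)%:R - K%:R by rewrite addrAC.
have -> : s + (f K)%:R - K%:R - 1 = s + (f K)%:R - K.+1%:R.
  by rewrite -natr1 opprD !addrA.
(* Either rows [K] and [K + 1] have equal lengths, and the last node of the
   former shares its residue with the position after the latter, or both
   indicators are 1. *)
have := f_dec K; rewrite leq_eqVlt => /orP[/eqP->|->]; rewrite ?ltnn /=; ring.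
Qed.

Lemma hub_content r e (a : {ffun 'I_r -> 'Z_e}) la l :
  hub a la l = 2 * (content a la l)%:Z - (content a la (l + 1))%:Z
    - (content a la (l - 1))%:Z - \sum_(k < r) (a k == l)%:R.
Proof.
set N := \max_(k < r) size (la k).
have part0 k : part (la k) N.+1 = 0%N.
  by rewrite part_default // ltnS (leq_bigmax (F := fun k => size (la k))).
rewrite ffunE (@removable_sum _ _ _ _ _ N) // (@addable_sum _ _ _ _ _ N) //.
rewrite !(@content_sum _ _ _ _ _ N) // mulr_sumr -!sumrB; apply: eq_bigr => k _.
have := @rim_telescope _ (fun x => (x == l)%:R) (a k) (fun i => part (la k) i.+1) N
  (fun i => part_geq _ (leqnSn _)).
(* Row [N] is empty, which removes the two boundary terms. *)
rewrite /= part0 addr0 addrK => /esym/(canRL (addrK _)) ->; congr (_ - _).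
rewrite mulr_sumr -!sumrB; apply: eq_bigr => i _.
rewrite mulr_sumr -!sumrB; apply: eq_bigr => j _.
set x := _ + j%:R.
by rewrite -[x == l + 1]subr_eq -[x == l - 1]subr_eq opprK.
Qed.

(** The case of an empty diagram in [hub_content]. *)
Lemma Theta_count r e (a : {ffun 'I_r -> 'Z_e}) l :
  Theta a l = - \sum_(k < r) (a k == l)%:R.
Proof.
have c0 l' : (content a (empty_multipartition r) l')%:Z = 0.
  rewrite (@content_sum _ _ _ _ _ 0) => [|k]; last by rewrite ffunE.
  by rewrite big1 // => k _; rewrite big_ord0.
by rewrite /Theta hub_content !c0; ring.
Qed.

Lemma hub_sub_Theta r e (a : {ffun 'I_r -> 'Z_e}) la l :
  hub a la l - Theta a l = 2 * (content a la l)%:Z - (content a la (l + 1))%:Z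
    - (content a la (l - 1))%:Z.
Proof. by rewrite hub_content Theta_count; ring. Qed.

Lemma sum_alpha e (m : 'Z_e -> nat) l :
  (\sum_(i : 'Z_e) alpha i *+ m i) l =
  2 * (m l)%:Z - (m (l + 1))%:Z - (m (l - 1))%:Z.
Proof.
have pick j : \sum_(i : 'Z_e) (i == j)%:R * (m i)%:Z = (m j)%:Z.
  rewrite (bigD1 j) //= eqxx mul1r big1 ?addr0 // => i /negbTE ->.
  by rewrite mul0r.
rewrite sum_ffunE.
transitivity (\sum_(i : 'Z_e) (2 * ((i == l)%:R * (m i)%:Z)
    - (i == l + 1)%:R * (m i)%:Z - (i == l - 1)%:R * (m i)%:Z)).
  apply: eq_bigr => i _; rewrite ffunMnE ffunE -mulr_natr natz.
  rewrite subr_eq -[i == l - 1]subr_eq opprK; ring.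
by rewrite !sumrB -mulr_sumr !pick.
Qed.

Lemma emapsto_hub r e (a : {ffun 'I_r -> 'Z_e}) la : emapsto (Theta a) (hub a la).
Proof.
exists (content a la); apply/ffunP => l.
rewrite [LHS]ffunE [X in _ + X]ffunE hub_sub_Theta.
by rewrite sum_alpha.
Qed.

Lemma has_hub_block r e (a : {ffun 'I_r -> 'Z_e}) la :
  has_hub a [set mu | content a mu = content a la] (hub a la).
Proof. by move=> mu /= eqc; apply/ffunP => l; rewrite !hub_content eqc. Qed.

(** * Moments modulo e *)

Lemma dvdz_moment_alpha e (i : 'Z_e) : (2 <= e)%N ->
  (e%:Z %| \sum_(0 <= x < e) x%:Z * alpha i x%:R)%Z.
Proof.
case: e i => [|[|e]] // i _.
rewrite big_mkord.
have pick (j : 'Z_e.+2) : \sum_(x < e.+2) x%:Z * (j == x%:R)%:R = (val j)%:Z.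
  rewrite (bigD1 j) //= natr_Zp eqxx mulr1 big1 ?addr0 // => x ne.
  by rewrite natr_Zp eq_sym (negbTE ne) mulr0.
under eq_bigr => x _ do rewrite ffunE.
transitivity (e.+2%:Z %| - (val (i - 1))%:Z + 2 * (val i)%:Z - (val (i + 1))%:Z)%Z.
  rewrite -!pick mulr_sumr -sumrN -big_split -sumrB; congr (_ %| _)%Z.
  by apply: eq_bigr => x _ /=; ring.
(* Representatives of consecutive residues differ by 1 up to a multiple of the
   modulus; the second difference of the representatives of [i - 1], [i] and
   [i + 1] is therefore such a multiple. *)
have succ (j : 'Z_e.+2) : exists q, (val (j + 1)%R + q * e.+2 = val j + 1)%N.
  exists ((val j + 1) %/ e.+2)%N; rewrite addnC /= [in RHS](divn_eq (val j + 1) e.+2).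
  by rewrite [(1 %% _)%N]modn_small.
have [q1] := succ (i - 1); have [q2] := succ i; rewrite subrK => e2 e1.
apply/dvdzP; exists (q2%:Z - q1%:Z); lia.
Qed.

Lemma dvdz_moment_sum e (m : 'Z_e -> nat) : (2 <= e)%N ->
  (e%:Z %| \sum_(0 <= x < e) x%:Z * (\sum_(i : 'Z_e) alpha i *+ m i) x%:R)%Z.
Proof.
move=> he.
rewrite (eq_bigr (fun x => \sum_(i : 'Z_e) x%:Z * alpha i x%:R *+ m i)) => [|x _].
  rewrite exchange_big; apply: rpred_sum => i _.
  by rewrite sumrMnl rpredMn // dvdz_moment_alpha.
by rewrite sum_ffunE mulr_sumr; apply: eq_bigr => i _; rewrite ffunMnE mulrnAr.
Qed.

(** The partial sums [S] of [d] solve the difference equation, also across the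
    wrap-around because [d] has total 0.  Their total is
    [sum (e - y) d_y = - sum y d_y], a multiple of [e] by hypothesis, so
    shifting all of them by an integer constant brings it to 0. *)
Lemma cyclic_primitive e (d : 'Z_e -> int) : (2 <= e)%N ->
    \sum_(l : 'Z_e) d l = 0 ->
    (e%:Z %| \sum_(0 <= x < e) x%:Z * d x%:R)%Z ->
  exists n : 'Z_e -> int,
    (forall l, n l - n (l - 1) = d l) /\ \sum_(l : 'Z_e) n l = 0.
Proof.
case: e d => [|[|e]] // d _ d0 /dvdzP[q moment].
pose S x := \sum_(0 <= y < x.+1) d y%:R.
have sumS m : \sum_(0 <= x < m) S x = \sum_(0 <= y < m) (m%:Z - y%:Z) * d y%:R.
  elim: m => [|m IH]; first by rewrite !big_geq.
  rewrite big_nat_recr // IH /S [in RHS]big_nat_recr //.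
  rewrite [X in _ + X = _]big_nat_recr //=.
  rewrite addrA -big_split /=; congr (_ + _); last by ring.
  by apply: eq_bigr => y _; ring.
have total : \sum_(0 <= y < e.+2) d y%:R = 0.
  by rewrite big_mkord -[RHS]d0; apply: eq_bigr => y _; rewrite natr_Zp.
exists (fun l => S (val l) + q); split=> [l|]; last first.
  rewrite big_split /= -(big_mkord xpredT S) sumS.
  rewrite [X in X + _](eq_bigr
    (fun y => e.+2%:Z * d y%:R - y%:Z * d y%:R)); last first.
    by move=> y _; rewrite mulrBl.
  by rewrite sumrB -mulr_sumr total moment sumr_const card_ord; ring.
rewrite opprD addrACA subrr addr0.
have -> : val (l - 1) = (if val l == 0 then e.+1 else (val l).-1)%N.
  case: l => [[|l] ltl] /=;
    rewrite [(1 %% _)%N]modn_small // modnDmr /Zp_trunc /=.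
    by rewrite add0n subn1 modn_small.
  by rewrite addSnnS subn1 modnDr modn_small // ltnW.
case: ifP => [/eqP l0|l0].
  by rewrite l0 /S total subr0 big_nat1 -l0 natr_Zp.
rewrite /S; case: (val l) l0 (natr_Zp l : (val l)%:R = l) => [//|x] _ <- /=.
by rewrite big_nat_recr //=; ring.
Qed.

(** * A partition with prescribed residues at the ends of its rows *)

(** Row [i] is given length [e * (size b - i)] plus a correction below [e] that
    brings its last node to the residue [b_i]; the steps of size [e] between
    rows absorb the corrections, so the lengths still decrease. *)
Lemma partition_of_row_ends e (s : 'Z_e) (b : seq 'Z_e) : (2 <= e)%N ->
  exists la : Defs.partition, part la (size b).+1 = 0%N /\
    forall i, (i < size b)%N -> s - i%:R + (part la i.+1)%:R - 1 = nth 0 b i.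
Proof.
case: e s b => [|[|e]] // s b _.
pose t i : nat := val (nth 0 b i - s + i%:R + 1).
pose f i := if (i < size b)%N then (e.+2 * (size b - i) + t i)%N else 0%N.
have [||la laP] := @partition_of_rows f (size b).
- move=> i; rewrite /f; case: (ltnP i.+1) => [lt1|//].
  rewrite (ltnW lt1); have : (t i.+1 < e.+2)%N by exact: ltn_ord.
  have -> : (size b - i = (size b - i.+1).+1)%N by lia.
  by rewrite mulnS => lt_t; lia.
- by rewrite /f ltnn.
exists la; split=> [|i lti]; rewrite laP /f ?ltnn // lti.
rewrite natrD natrM pchar_Zp // mul0r add0r natr_Zp; ring.
Qed.

Lemma seq_with_counts (T : finType) (m : T -> nat) :
  exists b : seq T, size b = (\sum_x m x)%N /\ forall x, count_mem x b = m x.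
Proof.
exists (flatten [seq nseq (m x) x | x <- enum T]); split=> [|x].
  rewrite size_flatten sumnE /shape 2!big_map big_enum.
  by apply: eq_bigr => x _; rewrite size_nseq.
rewrite count_flatten sumnE 2!big_map big_enum (bigD1 x) //= count_nseq /= eqxx mul1n.
by rewrite big1 ?addn0 // => y /negbTE ne; rewrite count_nseq /= ne.
Qed.

Lemma sum_nth_count (T : eqType) (x0 : T) (b : seq T) x :
  \sum_(i < size b) (nth x0 b i == x)%:R = (count_mem x b)%:Z.
Proof.
rewrite -sum1_count (big_nth x0) big_mkord -natz natr_sum [RHS]big_mkcond.
by apply: eq_bigr => i _ /=; case: eqP.
Qed.

Lemma sum_residues e (s l : 'Z_e) T : (2 <= e)%N ->
  \sum_(i < e * T) (s - i%:R == l)%:R = T%:Z.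
Proof.
case: e s l => [|[|e]] // s l _; elim: T => [|T IH]; first by rewrite muln0 big_ord0.
rewrite mulnS addnC big_split_ord /= IH.
suff -> : \sum_(i < e.+2) (s - (e.+2 * T + i)%:R == l)%:R = 1 :> int.
  by rewrite -natz natr1 natz.
rewrite (eq_bigr (fun i : 'Z_e.+2 => (i == s - l)%:R)) => [|i _].
  by rewrite (bigD1 (s - l)) // eqxx big1 ?addr0 // => i /negbTE ->.
rewrite natrD natrM pchar_Zp // mul0r add0r natr_Zp.
by rewrite subr_eq addrC -subr_eq eq_sym.
Qed.

(** The first difference of the content telescopes along each row: only the
    residue of the last node, and the one preceding that of the first node,
    remain. *)
Lemma content_single_component r e (a : {ffun 'I_r -> 'Z_e}) k0
    (mu : Defs.partition) N l :
    part mu N.+1 = 0%N ->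
  let la := [ffun k => if k == k0 then mu else empty_partition] in
  (content a la l)%:Z - (content a la (l + 1))%:Z =
  \sum_(i < N) ((a k0 - i%:R + (part mu i.+1)%:R - 1 == l)%:R
                - (a k0 - 1 - i%:R == l)%:R).
Proof.
move=> muN la.
have laN k : part (la k) N.+1 = 0%N.
  by rewrite /la ffunE; case: ifP => // _; rewrite /part nth_nil.
rewrite !(content_sum _ _ laN) -sumrB (bigD1 k0) //=.
rewrite [X in _ + X]big1 => [|k ne]; last first.
  move/negbTE: ne => ne.
  rewrite -sumrB big1 // => i _.
  by rewrite /la ffunE ne /part nth_nil !big_ord0.
rewrite addr0 -sumrB; apply: eq_bigr => i _; rewrite -sumrB ffunE eqxx.
rewrite [a k0 - 1 - _]addrAC -(telescope_shift (fun x => (x == l)%:R)).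
by apply: eq_bigr => j _; rewrite subr_eq.
Qed.

(** * Realising a hub *)

Lemma exists_hub r e (a : {ffun 'I_r -> 'Z_e}) (theta : {ffun 'Z_e -> int}) :
    (1 <= r)%N -> (2 <= e)%N -> is_ehub r theta ->
    (\sum_(0 <= x < e) x%:Z * theta x%:R
       = \sum_(0 <= x < e) x%:Z * Theta a x%:R %[mod e%:Z])%Z ->
  exists la : multipartition r, hub a la = theta.
Proof.
move=> hr he htheta moment.
have [||n [n_diff n_sum]] := @cyclic_primitive e (fun l => theta l - Theta a l) he.
- rewrite sumrB htheta; under eq_bigr do rewrite Theta_count.
  rewrite sumrN exchange_big /=.
  rewrite (eq_bigr (fun=> 1)) => [|k _].
    by rewrite sumr_const card_ord natz subrr.
  rewrite (bigD1 (a k)) //= eqxx big1 ?addr0 // => l.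
  by rewrite eq_sym => /negbTE ->.
- under eq_bigr do rewrite mulrBr.
  by rewrite sumrB -eqz_mod_dvd; apply/eqP.
(* Any [T] making all [T + n l] nonnegative will do. *)
pose T := (\sum_l `|n l|)%N.
have n_geT l : 0 <= T%:Z + n l.
  suff : (`|n l| <= T)%N by lia.
  by rewrite /T (bigD1 l) //= leq_addr.
have [b [b_size b_count]] := seq_with_counts (fun l => absz (T%:Z + n l)).
have {}b_size : size b = (e * T)%N.
  apply/eqP; rewrite -eqz_nat b_size -natz natr_sum.
  under eq_bigr do rewrite natz gez0_abs //.
  rewrite big_split n_sum /= sumr_const addr0 -mulr_natr natz -PoszM eqz_nat.
  by rewrite card_ord mulnC Zp_cast.
pose k0 := Ordinal hr.
have [mu [muN mu_ends]] := partition_of_row_ends (a k0) b he.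
pose la : multipartition r :=
  [ffun k => if k == k0 then mu else empty_partition].
have n_content l : n l = (content a la l)%:Z - (content a la (l + 1))%:Z.
  rewrite (content_single_component _ _ _ muN) sumrB.
  rewrite [X in _ - X](_ : _ = T%:Z); last by rewrite b_size sum_residues.
  under eq_bigr do rewrite mu_ends //.
  by rewrite sum_nth_count b_count gez0_abs // addrC addKr.
exists la; apply/ffunP => l; apply: (addIr (- Theta a l)).
by rewrite hub_sub_Theta -n_diff !n_content subrK; ring.
Qed.

Theorem theorem4p7 (r e : nat) (hr : (1 <= r)%N) (he : (2 <= e)%N)
    (a : {ffun 'I_r -> 'Z_e}) (theta : {ffun 'Z_e -> int})
    (htheta : is_ehub r theta) :
  [<-> exists B : set (multipartition r), is_block a B /\ has_hub a B theta;
       emapsto (Theta a) theta;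
       (\sum_(0 <= x < e) x%:Z * theta x%:R
          = \sum_(0 <= x < e) x%:Z * Theta a x%:R %[mod e%:Z])%Z].
Proof.
tfae.
- move=> [B [[la ->] hubB]]; rewrite -(hubB la erefl); exact: emapsto_hub.
- move=> [m eqm]; apply/eqP; rewrite eqz_mod_dvd -sumrB.
  rewrite (eq_bigr (fun x =>
      x%:Z * (\sum_(i : 'Z_e) alpha i *+ m i) x%:R)) => [|x _].
    exact: dvdz_moment_sum.
  by rewrite -eqm -mulrBr [(theta - Theta a) _]ffunE [(- Theta a) _]ffunE.
- move=> /(exists_hub hr he htheta)[la <-].
  exists [set mu | content a mu = content a la]; split; first by exists la.
  exact: has_hub_block.
Qed.
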